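(* Let $X$ be a non-empty finite set, $V^1,\dots,V^n:\Delta(X)\to\mathbb{R}$ continuous functions, $f:\mathbb{R}^n\to\mathbb{R}$ a differentiable function, and $\mu\in\Delta(X)$. If $P^*$ solves $$\sup_{P\in\Delta^2(X)} f\left(E_P[V^1],\dots,E_P[V^n]\right)\quad\text{s.t.}\quad E_P[\nu]=\mu,$$ then $$P^*\in\arg\max_{\substack{P\in\Delta^2(X)\\ E_P[\nu]=\mu}}\ \nabla f\left(E_{P^*}[V^1],\dots,E_{P^*}[V^n]\right)\cdot\left(E_P[V^1],\dots,E_P[V^n]\right).$$
   Context: $\Delta(X)\subset\mathbb{R}^{|X|}$ is the simplex of probability measures on the finite set $X$, and $\Delta^2(X)$ is the set of all Borel probability measures on $\Delta(X)$. For $P\in\Delta^2(X)$, $E_P[\nu]=\int_{\Delta(X)}\nu\,dP(\nu)$ is the barycenter and $E_P[V]=\int_{\Delta(X)}V(\nu)\,dP(\nu)$. ''$P^*$ solves'' a maximization problem means $P^*$ is feasible and attains the supremum. *)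

(* Defs.v *)
(* MathComp-Analysis *)
From HB Require Import structures.
From mathcomp Require Import all_boot all_order all_algebra.
From mathcomp Require Import all_classical all_reals all_analysis.

Set Implicit Arguments.
Unset Strict Implicit.
Unset Printing Implicit Defensive.

Import Order.TTheory GRing.Theory Num.Theory.
Import numFieldNormedType.Exports.

Local Open Scope classical_set_scope.
Local Open Scope ring_scope.

(* R^X carries the product topology, which for finite X is its usual one. *)
Definition simplex (R : realType) (X : finType) : set {ptws X -> R} :=
  [set p | (forall x, 0 <= p x) /\ \sum_(x : X) p x = 1].
Arguments simplex : clear implicits.

Lemma uniform_in_simplex (R : realType) (X : finType) (X0 : (0 < #|X|)%N) :
  (fun _ : X => #|X|%:R^-1) \in simplex R X.
Proof.
rewrite inE; split=> [x|]; first by rewrite invr_ge0 ler0n.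
by rewrite sumr_const -[_ *+ _]mulr_natl divff // pnatr_eq0 -lt0n.
Qed.

(* The non-emptiness proof X0 is a parameter of the type because measurable
   types are pointed; it only serves to build the point. *)
Definition Delta (R : realType) (X : finType) (X0 : (0 < #|X|)%N) : Type :=
  simplex R X.

HB.instance Definition _ (R : realType) (X : finType) (X0 : (0 < #|X|)%N) :=
  Topological.copy (Delta R X0) (set_type (simplex R X)).
HB.instance Definition _ (R : realType) (X : finType) (X0 : (0 < #|X|)%N) :=
  isPointed.Build (Delta R X0)
    (exist (fun p => p \in simplex R X) _ (uniform_in_simplex R X0)).

Definition Delta_val (R : realType) (X : finType) (X0 : (0 < #|X|)%N)
    (nu : Delta R X0) : X -> R := \val nu.

Coercion Delta_val : Delta >-> Funclass.

Definition Delta2 (R : realType) (X : finType) (X0 : (0 < #|X|)%N) : Type :=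
  probability (g_sigma_algebraType (@open (Delta R X0))) R.

Section information.
Context (R : realType) (X : finType) (X0 : (0 < #|X|)%N).
Implicit Types (P : Delta2 R X0).

Definition expect P (V : Delta R X0 -> R) : R := \int[P]_nu V nu.

Definition expects P (n : nat) (V : 'I_n -> Delta R X0 -> R) : 'rV[R]_n :=
  \row_i expect P (V i).

Definition barycenter P : X -> R := fun x => expect P (fun nu => nu x).

Definition feasible (mu : Delta R X0) : set (Delta2 R X0) :=
  [set P | barycenter P = mu].

End information.

Definition gradient (R : realType) (n : nat) (f : 'rV[R]_n -> R) (a : 'rV[R]_n)
  : 'rV[R]_n := \row_i 'D_(delta_mx 0 i) f a.

Definition dotv (R : realType) (n : nat) (u v : 'rV[R]_n) : R :=
  \sum_(i < n) u 0 i * v 0 i.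

(* The supremum is taken in the extended reals, so that it always exists. *)
Definition solves_sup (R : realType) (T : Type) (S : set T) (F : T -> R)
    (p : T) : Prop :=
  S p /\ (F p)%:E = ereal_sup [set (F q)%:E | q in S].

Definition argmax (R : realType) (T : Type) (S : set T) (F : T -> R) : set T :=
  [set p | S p /\ forall q, S q -> F q <= F p].

(* Main.v *)
Require Import Defs.
From HB Require Import structures.
From mathcomp Require Import all_boot all_order all_algebra.
From mathcomp Require Import all_classical all_reals all_analysis.
From mathcomp Require Import measurable_realfun.

Set Implicit Arguments.
Unset Strict Implicit.
Unset Printing Implicit Defensive.

Import Order.TTheory GRing.Theory Num.Theory.
Import numFieldNormedType.Exports.

Local Open Scope classical_set_scope.
Local Open Scope ring_scope.

(** The map sending P to the vector of expectations of the V i is affine, and so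
    is the barycenter; hence if P and Q are feasible, all their mixtures are
    (feasible_mixture), and their expectation vectors fill the segment from
    that of P to that of Q (expects_mixture).  Along the segment starting at
    the maximizer Pstar, f never exceeds its initial value, so its directional
    derivative there is nonpositive (derive_le0).  As f is differentiable, that
    derivative is the scalar product of the gradient with
    expects Q V - expects Pstar V (deriveE_gradient), and its sign is the
    optimality of Pstar for the linearized objective.

    Affinity of expectations rests on integrability: a continuous function on
    the simplex is Borel measurable, and bounded because the simplex is compact
    (continuous_Delta_bounded). *)

(** The positive and the negative part are scaled separately, and integrability keeps their
    difference meaningful. *)
Lemma integral_mscale d (T : measurableType d) (R : realType)
    (k : {nonneg R}) (m : {measure set T -> \bar R}) (D : set T)
    (f : T -> \bar R) : measurable D -> m.-integrable D f ->
  (\int[mscale k m]_(x in D) f x = k%:num%:E * \int[m]_(x in D) f x)%E.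
Proof.
move=> mD intf; have mf := measurable_int m intf.
have mfp := measurable_funepos mf; have mfn := measurable_funeneg mf.
have fE (mu : {measure set T -> \bar R}) : (\int[mu]_(x in D) f x
    = \int[mu]_(x in D) f^\+ x - \int[mu]_(x in D) f^\- x)%E.
  exact: integralE.
rewrite !fE !ge0_integral_mscale//.
by apply/esym/muleBr => //; exact: integrable_add_def.
Qed.

Section mixture.
Context d (T : measurableType d) (R : realType).
Implicit Types (t : {i01 R}) (P Q : probability T R).

Definition mixture t P Q : set T -> \bar R :=
  measure_add (mscale (1 - t%:num)%:nng P) (mscale t%:num%:nng Q).

HB.instance Definition _ t P Q := Measure.on (mixture t P Q).

Lemma mixture_setT t P Q : mixture t P Q setT = 1%E.
Proof.
transitivity ((1 - t%:num)%:E * P setT + t%:num%:E * Q setT)%E.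
  exact: measure_addE.
by rewrite !probability_setT !mule1 -EFinD subrK.
Qed.

HB.instance Definition _ t P Q :=
  Measure_isProbability.Build _ _ _ (mixture t P Q) (mixture_setT t P Q).

(** Boundedness makes the function integrable against every finite measure, so
    both sides are finite and the real-valued integral, which sends infinite
    values to 0, is affine in the measure. *)
Lemma Rintegral_mixture t P Q (f : T -> R) : measurable_fun setT f ->
    [bounded f x | x in setT] ->
  \int[mixture t P Q]_x f x
  = (1 - t%:num) * \int[P]_x f x + t%:num * \int[Q]_x f x.
Proof.
move=> mf bf.
have intf (m : {measure set T -> \bar R}) : (m setT < +oo)%E ->
    m.-integrable setT (fun x => (f x)%:E).
  by move=> mT; apply: measurable_bounded_integrable.
have PT (m : probability T R) : (m setT < +oo)%E by rewrite probability_setT ltry.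
have kPT (k : {nonneg R}) (m : probability T R) : (mscale k m setT < +oo)%E.
  have -> : mscale k m setT = (k%:num%:E * m setT)%E by [].
  by rewrite probability_setT mule1 ltry.
have intE (m : probability T R) :
    (\int[m]_x (f x)%:E)%E = (\int[m]_x f x)%:E.
  by rewrite fineK// integrable_fin_num//; exact: intf (PT m).
apply: EFin_inj; rewrite -intE EFinD !EFinM -!intE.
rewrite integral_measure_add.
- by rewrite !integral_mscale//; [exact: intf (PT Q)|exact: intf (PT P)].
- by [].
- exact: intf (kPT _ P).
- exact: intf (kPT _ Q).
Qed.

End mixture.

Section simplex_topology.
Context (R : realType) (X : finType).

Lemma coord_continuous (x : X) : continuous (fun p : {ptws X -> R} => p x).
Proof. exact: (@proj_continuous X (fun=> R)). Qed.

Lemma closed_simplex : closed (simplex R X).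
Proof.
rewrite (_ : simplex R X =
  (\bigcap_x [set p : {ptws X -> R} | 0 <= p x]) `&`
  [set p : {ptws X -> R} | \sum_x p x = 1]); last first.
  by apply/seteqP; split=> p [p0 p1]; split=> // x; [move=> _|]; exact: p0.
apply: closedI.
  apply: closed_bigI => x _; apply: (preimage_closed _ (@closed_ge R 0)) => p _.
  exact: coord_continuous.
apply: (@preimage_closed _ _ (fun p : {ptws X -> R} => \sum_x p x) [set 1]).
  move=> p _; apply: continuous_big => [|x _]; first exact: add_continuous.
  exact: coord_continuous.
exact: closed_eq.
Qed.

Lemma simplex_le1 (p : {ptws X -> R}) (x : X) : simplex R X p -> p x <= 1.
Proof.
by move=> [p0 <-]; rewrite (bigD1 x)//= lerDl sumr_ge0.
Qed.

(** A closed subset of the cube, which Tychonoff's theorem makes compact. *)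
Lemma compact_simplex : compact (simplex R X).
Proof.
have cube : compact [set p : {ptws X -> R} | forall x, `[0, 1]%classic (p x)].
  apply: (@tychonoff X (fun=> R) (fun=> `[0, 1]%classic)) => x.
  exact: segment_compact.
apply: subclosed_compact closed_simplex cube _.
by move=> p sp x /=; rewrite in_itv/= simplex_le1// sp.1.
Qed.

End simplex_topology.

Section Delta_theory.
Context (R : realType) (X : finType) (X0 : (0 < #|X|)%N).

(** The simplex is compact as a subset of the product space, whereas the domain
    of V is a subtype of it: extending V by a default value outside the simplex
    turns its range into the image of a compact set. *)
Lemma continuous_Delta_bounded (V : Delta R X0 -> R) :
  continuous V -> [bounded V nu | nu in setT].
Proof.
move=> cV.
have /compact_bounded [M [Mr bM]] : compact ((valL V : _ -> R) @` simplex R X).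
  apply: continuous_compact; last exact: compact_simplex.
  exact/subspace_valL_continuousP.
exists M; split=> // N MN nu _ /=; apply: (bM _ MN).
exists (\val nu); first exact/set_mem/valP.
exact: (congr1 (@^~ nu) (valLK point (V : simplex R X -> R))).
Qed.

Lemma continuous_Delta_measurable (V : Delta R X0 -> R) :
  continuous V ->
  measurable_fun setT (V : g_sigma_algebraType (@open (Delta R X0)) -> R).
Proof.
move=> /continuousP cV.
apply: (measurability _ (RGenOpens.measurableE R)) => _ [_ [a [b ->] <-]].
rewrite setTI; apply: sub_sigma_algebra; apply: cV; exact: interval_open.
Qed.

Lemma Delta_val_continuous (x : X) : continuous (fun nu : Delta R X0 => nu x).
Proof.
move=> nu; apply: (@continuous_comp _ _ _ (\val : simplex R X -> _)
  (fun p : {ptws X -> R} => p x)).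
  exact: initial_continuous.
exact: coord_continuous.
Qed.

Lemma expect_mixture (t : {i01 R}) (P Q : Delta2 R X0) (V : Delta R X0 -> R) :
  continuous V ->
  expect (mixture t P Q) V = expect P V + t%:num * (expect Q V - expect P V).
Proof.
move=> cV; rewrite /expect Rintegral_mixture.
- by rewrite mulrBl mul1r mulrBr addrAC addrA.
- exact: continuous_Delta_measurable.
- exact: continuous_Delta_bounded.
Qed.

(** The constraint is itself a family of expectations of continuous functions,
    the coordinates of a point of the simplex, hence affine. *)
Lemma feasible_mixture (mu : Delta R X0) (t : {i01 R}) (P Q : Delta2 R X0) :
  feasible mu P -> feasible mu Q -> feasible mu (mixture t P Q : Delta2 R X0).
Proof.
move=> Pmu Qmu; apply/funext => x; rewrite /barycenter expect_mixture.
  by rewrite -!/(barycenter _ x) Pmu Qmu subrr mulr0 addr0.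
exact: Delta_val_continuous.
Qed.

Lemma expects_mixture (t : {i01 R}) (P Q : Delta2 R X0) n
    (V : 'I_n -> Delta R X0 -> R) : (forall i, continuous (V i)) ->
  expects (mixture t P Q) V =
  expects P V + t%:num *: (expects Q V - expects P V).
Proof. by move=> cV; apply/rowP => i; rewrite !mxE expect_mixture. Qed.

End Delta_theory.

Section first_order.
Context (R : realType) (n : nat).

Lemma deriveE_gradient (f : 'rV[R]_n -> R) (a v : 'rV[R]_n) :
  differentiable f a -> 'D_v f a = dotv (gradient f a) v.
Proof.
move=> df; rewrite deriveE// [in LHS](row_sum_delta v) linear_sum /dotv.
by apply: eq_bigr => i _; rewrite linearZ/= mxE deriveE// mulrC.
Qed.

Lemma dotvBr (u v w : 'rV[R]_n) : dotv u (v - w) = dotv u v - dotv u w.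
Proof.
by rewrite /dotv -sumrB; apply: eq_bigr => i _; rewrite !mxE mulrBr.
Qed.

(** The first-order condition at one end of a segment: every difference quotient
    from the right is nonpositive, and the derivative is also their one-sided
    limit. *)
Lemma derive_le0 (V : normedModType R) (f : V -> R) (a v : V) :
  derivable f a v ->
  (forall t, 0 <= t <= 1 -> f (a + t *: v) <= f a) -> 'D_v f a <= 0.
Proof.
move=> df fa; apply: cvgr_to_le (cvg_dnbhs_at_right df) _.
near=> h; apply: mulr_ge0_le0; first by rewrite invr_ge0.
rewrite subr_le0 /= addrC; apply: fa; apply/andP; split=> //.
by near: h; exact: nbhs_right_le.
Unshelve. all: by end_near. Qed.

End first_order.

Theorem theorem2 (R : realType) (X : finType) (X0 : (0 < #|X|)%N) (n : nat)
  (V : 'I_n -> Delta R X0 -> R) (V_cont : forall i, continuous (V i))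
  (f : 'rV[R]_n -> R) (f_diff : forall a, differentiable f a)
  (mu : Delta R X0) (Pstar : Delta2 R X0) :
  solves_sup (feasible mu) (fun P => f (expects P V)) Pstar ->
  argmax (feasible mu)
    (fun P => dotv (gradient f (expects Pstar V)) (expects P V)) Pstar.
Proof.
move=> [Pmu Psup]; split=> // Q Qmu; set a := expects Pstar V.
have fmax P : feasible mu P -> f (expects P V) <= f a.
  by move=> Pf; rewrite -lee_fin Psup; apply: ereal_sup_ubound; exists P.
(* Both sides of the inequality become the derivative of f at a in the direction
   expects Q V - a, which is nonpositive because the segment from a to
   expects Q V consists of values at feasible mixtures. *)
rewrite /= -subr_le0 -dotvBr -deriveE_gradient//.
apply: derive_le0 => [|t /andP[t0 t1]]; first exact: diff_derivable.
have := fmax _ (feasible_mixture (Itv01 t0 t1) Pmu Qmu).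
by rewrite expects_mixture.
Qed.
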